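(* Let $n\ge 1$ be an integer, let $K\subset\mathbb{R}$ be a compact set and let $w:K\to[0,\infty)$ be a bounded upper semi-continuous function that is nonzero on at least $n+1$ points of $K$. Let $T_{n,w}^{(K)}$ be the weighted Chebyshev polynomial of degree $n$ on $K$ with respect to $w$. Then: 1. $T_{n,w}^{(K)}$ is real (i.e. has real coefficients). 2. Let $P_n$ be a real monic polynomial of degree $n$. Then $P_n=T_{n,w}^{(K)}$ if and only if $P_n$ has $n$ sign changes on the set of its $w$-extremal points on $K$, that is, there exist points $x_0<x_1<\dots<x_n$ in $K$ such that $$w(x_j)P_n(x_j)=(-1)^{n-j}\|P_n\|_{K,w},\qquad j=0,1,\ldots,n.$$
   Context: $\|P\|_{K,w}=\sup_{z\in K}w(z)|P(z)|$. The weighted Chebyshev polynomial $T_{n,w}^{(K)}$ is the (unique) monic polynomial of degree $n$ that minimizes $\|\cdot\|_{K,w}$ among all monic polynomials of degree $n$ with complex coefficients. A point $z\in K$ is a $w$-extremal point of $P$ on $K$ if $w(z)|P(z)|=\|P\|_{K,w}$. A function $w:K\to[0,\infty)$ is upper semi-continuous if $w(z)\ge\limsup_{K\ni\zeta\to z}w(\zeta)$ for each accumulation point $z$ of $K$. *)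

(* Defs.v *)
From HB Require Import structures.
From mathcomp Require Import all_boot all_order all_algebra.
From mathcomp Require Import complex.
From mathcomp Require Import all_classical all_reals all_analysis.

Set Implicit Arguments.
Unset Strict Implicit.
Unset Printing Implicit Defensive.

Import Order.TTheory GRing.Theory Num.Theory.
Import numFieldNormedType.Exports.

Local Open Scope classical_set_scope.
Local Open Scope complex_scope.
Local Open Scope ring_scope.

(* A weight on K is represented by a total function w : R -> R of which only the
   values on K are ever used.  The supremum is the real-valued [sup]: it is the
   intended one when K is nonempty and w * |P| is bounded above on K, in
   particular when K is nonempty and compact and w is nonnegative and bounded
   on K. *)
Definition wnorm (R : realType) (K : set R) (w : R -> R) (P : {poly R[i]}) : R :=
  sup [set w x * Normc.normc P.[x%:C] | x in K].

Definition monic_of_degree (F : nzRingType) (n : nat) (P : {poly F}) : Prop :=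
  P \is monic /\ size P = n.+1.

Definition weighted_chebyshev (R : realType) (n : nat) (K : set R) (w : R -> R)
    (T : {poly R[i]}) : Prop :=
  monic_of_degree n T /\
  forall Q : {poly R[i]}, monic_of_degree n Q -> wnorm K w T <= wnorm K w Q.

(* [Num.real] is the set of complex numbers with zero imaginary part. *)
Definition real_poly (R : realType) (P : {poly R[i]}) : Prop :=
  P \is a polyOver Num.real.

(* [z^'] is the filter of punctured neighbourhoods of z; accumulation points of
   K outside K are not considered because w is only meaningful on K. *)
Definition upper_semicontinuous_on (R : realType) (K : set R) (w : R -> R) : Prop :=
  forall z : R, K z -> limit_point K z ->
    (limf_esup (fun x => (w x)%:E) (within K z^') <= (w z)%:E)%E.

(* Main.v *)
(** If [P] alternates at [x_0 < ... < x_n] and [T] is a minimizer, then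
    [D = P - Re T] has degree less than [n] and [(-1)^(n-j) D(x_j) >= 0]; as the
    [n]-th divided difference of [D] vanishes, [D] vanishes at all the [x_j],
    hence [P = Re T], and then [Im T] vanishes at the [x_j] as well.
    Conversely [Re T] is again a minimizer.  If it did not alternate, some
    polynomial [D] of degree at most [n], with nonpositive coefficient of degree
    [n], would have the sign of [Re T] at every extremal point; then
    [(Re T - e D) / (1 - e D_n)] would be monic of smaller norm for small [e > 0].
    So [Re T] alternates, and by the first part it is equal to [T]. *)

Require Import Defs.
From HB Require Import structures.
From mathcomp Require Import all_boot all_order all_algebra.
From mathcomp Require Import complex.
From mathcomp Require Import all_classical all_reals all_analysis.
From mathcomp Require Import lra.

Set Implicit Arguments.
Unset Strict Implicit.
Unset Printing Implicit Defensive.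

Import Order.TTheory GRing.Theory Num.Theory.
Import numFieldNormedType.Exports.

Local Open Scope classical_set_scope.
Local Open Scope complex_scope.
Local Open Scope ring_scope.

(** * Upper semi-continuous weights on compact sets *)

(** The upper limit leaves out [z] itself, where the bound is trivial. An isolated point of [K] has
    no other point of [K] nearby, so the bound is trivial there too. *)
Lemma usc_near (R : realType) (K : set R) (w : R -> R) (z e : R) :
  upper_semicontinuous_on K w -> K z -> 0 < e ->
  \forall x \near z, K x -> w x < w z + e.
Proof.
move=> usc Kz e0; have [lz|nlz] := pselect (limit_point K z).
  have /ereal_inf_lt[_ [V VF <-] Ve] :
      (limf_esup (fun x => (w x)%:E) (within K z^') < (w z + e)%:E)%E.
    by apply: (le_lt_trans (usc z Kz lz)); rewrite lte_fin ltrDl.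
  have VF' : \forall x \near z, x != z -> K x -> V x := VF.
  near=> x => Kx; have [->|xz] := eqVneq x z; first by rewrite ltrDl.
  rewrite -lte_fin; apply: le_lt_trans Ve; apply: ereal_sup_ubound.
  exists x => //; have VKx : x != z -> K x -> V x by near: x.
  exact: VKx.
have [U [Uz UK]] : exists U, nbhs z U /\ ~ exists y, [/\ y != z, K y & U y].
  by apply: contra_notP nlz => nU U Uz; apply: contra_notP nU => nU; exists U.
near=> x => Kx; have [->|xz] := eqVneq x z; first by rewrite ltrDl.
have Ux : U x by near: x.
by case: UK; exists x.
Unshelve. all: by end_near. Qed.

(** Upper semi-continuity survives multiplication by the absolute value of a continuous function.
    The parameter [i] suits the near-covering form of compactness, where it is a large bound or a
    small positive number. *)
Lemma weighted_lt_near (R : realType) (K : set R) (w : R -> R) (z c m : R)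
    (I : Type) (F : set_system I) (g : R -> I -> R) :
  Filter F -> (forall x, K x -> 0 <= w x) -> upper_semicontinuous_on K w ->
  K z -> (fun p => g p.1 p.2) @ filter_prod (nbhs z) F --> c ->
  w z * `|c| < m ->
  \forall x \near z & i \near F, K x -> w x * `|g x i| < m.
Proof.
move=> FF w0 usc Kz gc wm.
have wz0 := w0 z Kz; have c0 := normr_ge0 c.
set b := w z + `|c| + 1.
have b0 : 0 < b by rewrite /b; lra.
(* As [e <= 1], the product of [w z + e] and [|c| + e] is at most [w z * |c| + e * b], and [e * b]
   is at most half of the gap [m - w z * |c|]. *)
set e := Num.min 1 ((m - w z * `|c|) / (2 * b)).
have e0 : 0 < e by rewrite /e lt_min ltr01 divr_gt0 //; [lra | lra].
have e1 : e <= 1 by rewrite /e ge_min lexx.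
have eb : e * (2 * b) <= m - w z * `|c|.
  by rewrite -ler_pdivlMr ?mulr_gt0// /e ge_min lexx orbT.
have wge : \forall x \near z & i \near F, K x -> w x < w z + e.
  exact: (cvg_fst (usc_near usc Kz e0)).
have gce : \forall x \near z & i \near F, `|c - g x i| < e.
  by move/cvgrPdist_lt : gc => /(_ e e0).
move: wge gce; apply: filterS2 => -[x i] /= h1 h2 Kx; have {}h1 := h1 Kx.
have h3 : `|g x i| <= `|c| + e.
  have := ler_normD c (g x i - c); rewrite addrCA subrr addr0 distrC; lra.
have : w x * `|g x i| <= (w z + e) * (`|c| + e) by apply: ler_pM => //; [exact: w0|lra].
rewrite /b in eb b0 *; nra.
Qed.

Lemma weighted_max (R : realType) (K : set R) (w g : R -> R) :
  compact K -> K !=set0 -> (forall x, K x -> 0 <= w x) ->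
  upper_semicontinuous_on K w -> continuous g ->
  exists2 x, K x & forall y, K y -> w y * `|g y| <= w x * `|g x|.
Proof.
move=> cK [k Kk] w0 usc cg; pose f x := w x * `|g x|.
have fz z (I : Type) (F : set_system I) (FF : Filter F) m : K z -> f z < m ->
    \forall x \near z & i \near F, K x -> f x < m.
  move=> Kz fm; apply: (@weighted_lt_near _ K w z (g z) m I F (fun x _ => g x)) => //.
  by apply: (@cvg_comp _ _ _ fst g _ (nbhs z)); [exact: cvg_fst|exact: cg].
(* Boundedness comes first: without it the real [sup] would be a default value. *)
have [M KM] : exists M, forall x, K x -> f x < M.
  have near_lt : \forall M \near pinfty_nbhs R, K `<=` (fun x => K x -> f x < M).
    move/compact_near_coveringP : cK; apply => z Kz.
    have flt : \forall x \near z & M \near pinfty_nbhs R, K x -> f x < f z + 1.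
      by apply: fz; rewrite ?ltrDl.
    have Mgt : \forall x \near z & M \near pinfty_nbhs R, f z + 1 < M.
      exact: (cvg_snd (nbhs_pinfty_gt (num_real (f z + 1)))).
    move: flt Mgt; apply: filterS2 => -[x M] /= fx fM Kx.
    exact: lt_trans (fx Kx) fM.
  by have [M KM] := @filter_ex _ _ _ _ near_lt; exists M => x Kx; exact: KM.
pose S := sup (f @` K).
have ubS : has_ubound (f @` K).
  by exists M => _ [x Kx <-]; exact/ltW/KM.
have fS y : K y -> f y <= S by move=> Ky; apply: ub_le_sup => //; exists y.
apply: contrapT => nmax.
have fltS z : K z -> f z < S.
  move=> Kz; rewrite lt_neqAle fS// andbT; apply/eqP => fzS; apply: nmax.
  by exists z => // y /fS; rewrite -fzS.
(* If [S] is not attained, compactness turns the pointwise [f z < S] into a uniform gap [e], so that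
   [S - e] is a smaller upper bound. *)
have near_lt : \forall e \near 0^'+, K `<=` (fun x => K x -> f x < S - e).
  move/compact_near_coveringP : cK; apply => z Kz.
  have fzS := fltS z Kz; pose m := (f z + S) / 2.
  have fm : f z < m by rewrite /m; lra.
  have mS : 0 < S - m by rewrite /m; lra.
  have elt : \forall x \near z & e \near (0:R)^'+, e < S - m.
    exact: (cvg_snd (nbhs_right_lt mS)).
  have flt : \forall x \near z & e \near (0:R)^'+, K x -> f x < m by exact: fz.
  move: flt elt; apply: filterS2 => -[x e] /= fx em Kx.
  have := fx Kx; lra.
have [e [e0 Ke]] : exists e, 0 < e /\ forall x, K x -> f x < S - e.
  near (0:R)^'+ => e; exists e; split; first by near: e; exact: nbhs_right_gt.
  by move=> x Kx; move: (Kx); apply: (near near_lt e).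
have : S <= S - e.
  apply: ge_sup; first by exists (f k); exists k.
  by move=> _ [x Kx <-]; exact/ltW/Ke.
lra.
Unshelve. all: by end_near. Qed.

(** * Divided differences and sign changes *)

Lemma poly_eq0_at (F : fieldType) n (x : 'I_n -> F) (p : {poly F}) :
  injective x -> (size p <= n)%N -> (forall j, p.[x j] = 0) -> p = 0.
Proof.
move=> xI sp px; apply: (@roots_geq_poly_eq0 _ _ [seq x j | j <- enum 'I_n]).
- by apply/allP => _ /mapP[j _ ->]; apply/eqP.
- by rewrite map_inj_uniq ?enum_uniq.
- by rewrite size_map size_enum_ord.
Qed.

(** Compare the coefficients of degree [n] in the Lagrange interpolation formula: every nodal
    product [L j] is monic of degree [n]. *)
Lemma divided_difference (F : fieldType) n (x : 'I_n.+1 -> F) (p : {poly F}) :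
  injective x -> (size p <= n.+1)%N ->
  \sum_j p.[x j] / \prod_(k | k != j) (x j - x k) = p`_n.
Proof.
move=> xI sp; pose L (j : 'I_n.+1) := \prod_(k | k != j) ('X - (x k)%:P).
have LE j : L j = \prod_(k <- enum (predC1 j)) ('X - (x k)%:P) by rewrite big_enum.
have sL j : size (L j) = n.+1.
  by rewrite LE size_prod_XsubC -cardE cardC1 card_ord.
have Ln j : (L j)`_n = 1.
  have /monicP := monic_prod_XsubC (enum (predC1 j)) predT x.
  by rewrite -LE lead_coefE sL.
have Lx j i : (L j).[x i] = if i == j then \prod_(k | k != j) (x j - x k) else 0.
  rewrite horner_prod; case: eqP => [->|/eqP ij].
    by apply: eq_bigr => k _; rewrite hornerXsubC.
  by rewrite (bigD1 i)//= hornerXsubC subrr mul0r.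
pose c j := p.[x j] / \prod_(k | k != j) (x j - x k).
have pE : p = \sum_j c j *: L j.
  apply/eqP; rewrite -subr_eq0; apply/eqP; apply: (poly_eq0_at xI).
    rewrite (leq_trans (size_polyD _ _))// geq_max sp size_polyN.
    apply: (leq_trans (size_sum _ _ _)); apply/bigmax_leqP => j _.
    by rewrite (leq_trans (size_scale_leq _ _))// sL.
  move=> i; rewrite hornerD hornerN horner_sum (bigD1 i)//= big1 => [|j ji].
    rewrite hornerZ Lx eqxx addr0 divfK ?subrr//.
    by apply/prodf_neq0 => k ki; rewrite subr_eq0 inj_eq// eq_sym.
  by rewrite hornerZ Lx eq_sym (negPf ji) mulr0.
rewrite [in RHS]pE coef_sum; apply: eq_bigr => j _.
by rewrite coefZ Ln mulr1.
Qed.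

(** Exactly the [n - j] factors with [k > j] are negative. *)
Lemma sign_prod_sub (R : realFieldType) n (x : 'I_n.+1 -> R) (j : 'I_n.+1) :
  (forall i k : 'I_n.+1, (i < k)%N -> x i < x k) ->
  0 < (-1) ^+ (n - j) * \prod_(k | k != j) (x j - x k).
Proof.
move=> incr.
have -> : (-1) ^+ (n - j) =
    \prod_(k < n.+1 | k != j) (if (j < k)%N then -1 else 1) :> R.
  rewrite -(subSS j) -prodr_const_nat big_geq_mkord -big_mkcondr/=.
  by apply: eq_bigl => k; rewrite andb_idl// => /gtn_eqF; rewrite -val_eqE => /= ->.
rewrite -big_split/= prodr_gt0// => k kj; case: ltngtP => [jk|kj'|/val_inj jk].
- by rewrite mulN1r oppr_gt0 subr_lt0 incr.
- by rewrite mul1r subr_gt0 incr.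
- by rewrite jk eqxx in kj.
Qed.

Lemma increasing_inj (R : realFieldType) n (x : 'I_n -> R) :
  (forall i k : 'I_n, (i < k)%N -> x i < x k) -> injective x.
Proof.
move=> incr i k xik; apply/val_inj; case: (ltngtP i k) => // /incr;
  by rewrite xik ltxx.
Qed.

(* All terms of the n-th divided difference of D have the same sign, but their
   sum is the coefficient of degree n, which vanishes. *)
Lemma alternating_poly_eq0 (R : realFieldType) n (x : 'I_n.+1 -> R) (D : {poly R}) :
  (forall i k : 'I_n.+1, (i < k)%N -> x i < x k) -> (size D <= n)%N ->
  (forall j : 'I_n.+1, 0 <= (-1) ^+ (n - j) * D.[x j]) -> D = 0.
Proof.
move=> incr sD Dsign; have xI := increasing_inj incr.
apply: (poly_eq0_at xI) => [|j]; first exact: leqW.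
pose q j := \prod_(k | k != j) (x j - x k).
have term_ge0 (i : 'I_n.+1) : true -> 0 <= D.[x i] / q i.
  move=> _; rewrite -[D.[x i]](signrMK (n - i)) -[q i](signrMK (n - i)) invfM.
  rewrite mulrACA mulrV ?unitrX ?unitrN ?unitr1// mul1r.
  by rewrite divr_ge0// ltW// sign_prod_sub.
have /eqP := divided_difference xI (leqW sD); rewrite nth_default// psumr_eq0//.
move=> /allP/(_ j (mem_index_enum j))/=; rewrite mulf_eq0 invr_eq0 => /orP[/eqP//|].
by move=> /eqP q0; have := sign_prod_sub j incr; rewrite q0 mulr0 ltxx.
Qed.

(** * Alternating chains of points, or a polynomial separating the two sets *)

(* Greedy choice from the right: the last point is (nearly) the supremum of A,
   the others come from the points of B on its left, with A and B exchanged. *)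
Lemma alternating_chain_or_poly (R : realType) k (A B : set R) (d u : R) :
  0 < d -> (forall a b, A a -> B b -> d <= `|a - b|) ->
  (forall x, A x -> x <= u - d) -> (forall x, B x -> x <= u - d) ->
  (exists y : nat -> R,
     (forall i, (i <= k)%N -> (if odd i then B else A) (y i)) /\
     forall i, (i < k)%N -> y i.+1 < y i) \/
  (exists D : {poly R}, [/\ (size D <= k.+1)%N, D`_k <= 0,
     forall x, A x -> 0 < D.[x], forall x, B x -> D.[x] < 0 &
     forall x, u <= x -> D.[x] < 0]).
Proof.
have empty m (A' B' : set R) v : A' = set0 -> exists D : {poly R},
    [/\ (size D <= m.+1)%N, D`_m <= 0, forall x, A' x -> 0 < D.[x],
        forall x, B' x -> D.[x] < 0 & forall x, v <= x -> D.[x] < 0].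
  move=> ->; exists (-1)%:P; split=> // [||x _|x _].
  - by rewrite (leq_trans (size_polyC_leq1 _)).
  - by rewrite coefC; case: ifP; rewrite ?lerN10.
  - by rewrite hornerC ltrN10.
  - by rewrite hornerC ltrN10.
elim: k A B d u => [|k IH] A B d u d0 AB Au Bu;
  have [A0|/set0P[a0 Aa0]] := eqVneq A set0; try by right; exact: empty.
  by left; exists (fun=> a0); split=> // i; rewrite leqn0 => /eqP ->.
have hA : has_sup A by split; [exists a0|exists (u - d) => x /Au].
have sA x : A x -> x <= sup A by move=> Ax; apply: ub_le_sup => //; case: hA.
have su : sup A <= u - d by apply: ge_sup; [exists a0|move=> x /Au].
have [a Aa sa] : exists2 a, A a & sup A - d / 2 < a by apply: sup_adherent => //; lra.
(* Points of [B] beyond [a] exceed [a + d / 2 + d / 4], hence [t], while all of [A] stays below [t]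
   by at least [d / 4], the gap used in the recursive call. *)
pose t := sup A + d / 4.
have Bt x : B x -> a <= x -> t < x.
  move=> Bx ax; have := AB a x Aa Bx; rewrite distrC ger0_norm ?subr_ge0//.
  by rewrite /t; lra.
(* The recursion drops the points of [B] to the right of [a]. The condition on [[t, +oo)] keeps
   control of the sign there. *)
have [[y [yAB ydec]]|[D [sD Dk DB DA Dt]]] :
    (exists y : nat -> R,
       (forall i, (i <= k)%N -> (if odd i then A else [set b | B b /\ b < a]) (y i)) /\
       forall i, (i < k)%N -> y i.+1 < y i) \/
    (exists D : {poly R}, [/\ (size D <= k.+1)%N, D`_k <= 0,
       forall x, [set b | B b /\ b < a] x -> 0 < D.[x], forall x, A x -> D.[x] < 0 &
       forall x, t <= x -> D.[x] < 0]).
- apply: (IH _ _ (d / 4)); first lra.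
  + by move=> b c [Bb _] Ac; rewrite distrC; have := AB _ _ Ac Bb; lra.
  + by move=> b [_ ba]; have := sA a Aa; rewrite /t; lra.
  + by move=> x /sA; rewrite /t; lra.
- left; exists (fun i => if i is i'.+1 then y i' else a); split=> [[|i] ik //=|[|i] ik].
  + by have := yAB i ik; case: odd => //= -[].
  + by have [] := yAB 0%N (leq0n _).
  + exact: ydec.
- right; exists (D * ('X - t%:P)); split.
  + by rewrite (leq_trans (size_polyMleq _ _))// size_XsubC addn2.
  + by rewrite mulrBr coefB coefMX/= coefMC (nth_default 0 sD) mul0r subr0.
  + move=> x Ax; rewrite hornerM hornerXsubC nmulr_rgt0 ?DA// subr_lt0.
    by have := sA x Ax; rewrite /t; lra.
  + move=> x Bx; rewrite hornerM hornerXsubC; have [xa|ax] := ltP x a.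
      rewrite pmulr_rlt0 ?DB// subr_lt0; have := sA a Aa; rewrite /t; lra.
    by rewrite nmulr_rlt0 ?subr_gt0 ?Bt// Dt// ltW// Bt.
  + move=> x ux; have tx : t < x by rewrite /t; lra.
    by rewrite hornerM hornerXsubC nmulr_rlt0 ?subr_gt0// Dt// ltW.
Qed.

(** * Separation of extremal points and decrease of the norm *)

(** Near a point where [g] is nonzero its sign is constant, which excludes one of the two values.
    Near a zero of [g], upper semi-continuity keeps [w * |g|] below [M]. Compactness makes the
    distance uniform. *)
Lemma extremal_points_separated (R : realType) (K : set R) (w g : R -> R) (M : R) :
  compact K -> (forall x, K x -> 0 <= w x) -> upper_semicontinuous_on K w ->
  continuous g -> 0 < M ->
  exists2 d, 0 < d & forall a b, K a -> K b -> w a * g a = M ->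
    w b * g b = - M -> d <= `|a - b|.
Proof.
move=> cK w0 usc cg M0.
suff near_sep : \forall d \near (0:R)^'+, K `<=` (fun a => forall b, K a -> K b ->
    w a * g a = M -> w b * g b = - M -> d <= `|a - b|).
  near (0:R)^'+ => d; exists d; first by near: d; exact: nbhs_right_gt.
  by move=> a b Ka; apply: (near near_sep d).
move/compact_near_coveringP : cK; apply => z Kz.
have [gz|gz|gz] := ltgtP (g z) 0.
- have glt : \forall x \near z, g x < 0 by exact: (cvgr_lt _ (cg z)).
  have : \forall x \near z & d \near (0:R)^'+, g x < 0 by exact: (cvg_fst glt).
  apply: filterS => -[x d] /= gx b Kx Kb wgM.
  by have := w0 x Kx; nra.
- have ggt : \forall x \near z, 0 < g x by exact: (cvgr_gt _ (cg z)).
  have [r /= r0 gr] : exists2 r : R, 0 < r & forall y, `|z - y| < r -> 0 < g y.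
    by have /nbhs_ballP[r r0 gr] := ggt; exists r.
  (* If [a] is within [r / 2] of [z] and [b] within [r / 2] of [a], then [b] lies in the ball where
     [g] is positive. *)
  have r2 : 0 < r / 2 by lra.
  have zx : \forall x \near z & d \near (0:R)^'+, `|z - x| < r / 2.
    exact: (cvg_fst (nbhsx_ballx z _ r2)).
  have dr : \forall x \near z & d \near (0:R)^'+, d < r / 2.
    exact: (cvg_snd (nbhs_right_lt r2)).
  move: zx dr; apply: filterS2 => -[x d] /= zx dr b Kx Kb _ wgb.
  rewrite leNgt; apply/negP => xb.
  have gb : 0 < g b by apply: gr; have := ler_distD x z b; lra.
  by have := w0 b Kb; nra.
- have : \forall x \near z & d \near (0:R)^'+, K x -> w x * `|g x| < M.
    apply: (weighted_lt_near (c := g z)) => //; last by rewrite gz normr0 mulr0.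
    by apply: (@cvg_comp _ _ _ fst g _ (nbhs z)); [exact: cvg_fst|exact: cg].
  apply: filterS => -[x d] /= wgx b Kx Kb wgM.
  have := wgx Kx; have := w0 x Kx; have := ler_norm (g x); nra.
Unshelve. all: by end_near. Qed.

(** By compactness it suffices to find a bound near each [z]. Where [w * |g| < M], the strict
    inequality persists for small [e]; where equality holds, [g] and [h] have the same sign and
    subtracting [e * h] shrinks [|g|]. *)
Lemma weighted_perturbation (R : realType) (K : set R) (w g h : R -> R) (M : R) :
  compact K -> (forall x, K x -> 0 <= w x) -> upper_semicontinuous_on K w ->
  continuous g -> continuous h -> 0 < M ->
  (forall x, K x -> w x * `|g x| <= M) ->
  (forall x, K x -> w x * g x = M -> 0 < h x) ->
  (forall x, K x -> w x * g x = - M -> h x < 0) ->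
  exists2 e, 0 < e & forall x, K x -> w x * `|g x - e * h x| < M.
Proof.
move=> cK w0 usc cg ch M0 gM hpos hneg.
suff near_lt : \forall e \near (0:R)^'+,
    K `<=` (fun x => K x -> w x * `|g x - e * h x| < M).
  near (0:R)^'+ => e; exists e; first by near: e; exact: nbhs_right_gt.
  by move=> x Kx; move: (Kx); apply: (near near_lt e).
move/compact_near_coveringP : cK; apply => z Kz.
have c1 (k : R -> R) : continuous k ->
    (fun p : R * R => k p.1) @ filter_prod (nbhs z) (0:R)^'+ --> k z.
  by move=> ck; apply: (@cvg_comp _ _ _ fst k _ (nbhs z)); [exact: cvg_fst|exact: ck].
have cgh :
    (fun p : R * R => g p.1 - p.2 * h p.1) @ filter_prod (nbhs z) (0:R)^'+ --> g z.
  have gz0 : g z - 0 * h z = g z by rewrite mul0r subr0.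
  rewrite -[X in _ --> X]gz0; apply: cvgB; first exact: c1.
  apply: cvgM; last exact: c1.
  by apply: (cvg_trans cvg_snd); exact: cvg_within.
have := gM z Kz; rewrite le_eqVlt => /orP[/eqP gzM|gzM]; last first.
  exact: (weighted_lt_near (g := fun x e => g x - e * h x) _ w0 usc Kz cgh).
have wz : 0 < w z.
  by rewrite lt_neqAle w0// andbT; apply/eqP => wz; move: gzM; rewrite -wz mul0r; lra.
have ghz : 0 < g z * h z.
  have [gz|gz|gz] := ltgtP (g z) 0.
  - rewrite nmulr_rgt0// hneg//; rewrite ltr0_norm// in gzM; lra.
  - by rewrite pmulr_rgt0// hpos//; rewrite gtr0_norm// in gzM.
  - by move: gzM; rewrite gz normr0; lra.
have ggz : 0 < g z * g z.
  by rewrite -expr2 exprn_even_gt0//=; apply: contraTneq ghz => ->; rewrite mul0r ltxx.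
(* At an extremal [z] semi-continuity alone gives no strict bound nearby. Instead
   [|g - e * h| < |g|] is shown at each nearby point and combined with [w * |g| <= M]. *)
have ghx : \forall x \near z & e \near (0:R)^'+, 0 < g x * h x.
  by apply: (cvgr_gt _ (cvgM (c1 g cg) (c1 h ch))).
have ggx : \forall x \near z & e \near (0:R)^'+, 0 < g x * (g x - e * h x).
  by apply: (cvgr_gt _ (cvgM (c1 g cg) cgh)).
have e0 : \forall x \near z & e \near (0:R)^'+, 0 < e.
  exact: (cvg_snd (nbhs_right_gt (0:R))).
move: ghx ggx e0; apply: filterS3 => -[x e] /= ghx ggx e0 Kx.
have lt_g : `|g x - e * h x| < `|g x|.
  have [gx|gx|gx] := ltgtP (g x) 0.
  - rewrite nmulr_rgt0// in ghx; rewrite nmulr_rgt0// in ggx.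
    have : e * h x < 0 by rewrite pmulr_rlt0.
    by rewrite !ltr0_norm//; lra.
  - rewrite pmulr_rgt0// in ghx; rewrite pmulr_rgt0// in ggx.
    have : 0 < e * h x by rewrite pmulr_rgt0.
    by rewrite !gtr0_norm//; lra.
  - by move: ghx; rewrite gx mul0r ltxx.
have := w0 x Kx; rewrite le_eqVlt => /orP[/eqP <-|wx]; first by rewrite mul0r.
by apply: lt_le_trans (gM x Kx); rewrite ltr_pM2l.
Unshelve. all: by end_near. Qed.

(** * Real and imaginary parts of complex polynomials *)

Local Notation toC := (map_poly (real_complex _)).
Local Notation reP := (map_poly (@complex.Re _)).
Local Notation imP := (map_poly (@complex.Im _)).

(** Powers of a real [x] are real, so real parts can be taken term by term. The wide form of the sum
    is used because [reP T] may have smaller degree than [T]. *)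
Lemma Re_horner (R : realType) (T : {poly R[i]}) (x : R) :
  complex.Re T.[x%:C] = (reP T).[x].
Proof.
rewrite horner_coef (horner_coef_wide _ (size_poly _ _)).
rewrite (big_morph (@complex.Re R) (id1 := 0) (op1 := +%R)) //;
  last by case=> a b [c d].
apply: eq_bigr => j _; rewrite coef_map_id0// -rmorphXn.
by case: T`_j => a b /=; rewrite mulr0 subr0.
Qed.

Lemma Im_horner (R : realType) (T : {poly R[i]}) (x : R) :
  complex.Im T.[x%:C] = (imP T).[x].
Proof.
rewrite horner_coef (horner_coef_wide _ (size_poly _ _)).
rewrite (big_morph (@complex.Im R) (id1 := 0) (op1 := +%R)) //;
  last by case=> a b [c d].
apply: eq_bigr => j _; rewrite coef_map_id0// -rmorphXn.
by case: T`_j => a b /=; rewrite mulr0 add0r.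
Qed.

Lemma normc_real (R : realType) (a : R) : Normc.normc a%:C = `|a|.
Proof. by rewrite /Normc.normc /= expr0n /= addr0 sqrtr_sqr. Qed.

Lemma normc_ge_absRe (R : realType) (z : R[i]) : `|complex.Re z| <= Normc.normc z.
Proof. by case: z => a b /=; rewrite -sqrtr_sqr ler_wsqrtr// lerDl sqr_ge0. Qed.

Lemma normc_le_absReIm (R : realType) (z : R[i]) :
  Normc.normc z <= `|complex.Re z| + `|complex.Im z|.
Proof.
case: z => a b /=; rewrite -[leRHS]ger0_norm ?addr_ge0// -sqrtr_sqr ler_wsqrtr//.
by rewrite sqrrD !real_normK ?num_real// -addrA lerD2l lerDr mulrn_wge0// mulr_ge0.
Qed.

Lemma real_polyE (R : realType) (P : {poly R[i]}) :
  real_poly P -> toC (reP P) = P.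
Proof.
move=> /polyOverP Preal; apply/polyP => j.
by rewrite coef_map coef_map_id0//= RRe_real.
Qed.

Lemma real_poly_map (R : realType) (p : {poly R}) : real_poly (toC p).
Proof. by apply/polyOverP => j; rewrite coef_map/= complex_real eqxx. Qed.

Lemma monic_of_degree_Re (R : realType) n (T : {poly R[i]}) :
  monic_of_degree n T -> monic_of_degree n (reP T).
Proof.
move=> [/monicP]; rewrite lead_coefE => + sT; rewrite sT/= => Tn.
have Rn : (reP T)`_n = 1 by rewrite coef_map_id0// Tn.
have sR : size (reP T) = n.+1.
  apply/eqP; rewrite eqn_leq -{1}sT size_poly/= ltnNge; apply/negP => sR.
  by move: Rn; rewrite nth_default// => /eqP; rewrite eq_sym oner_eq0.
by split=> //; apply/monicP; rewrite lead_coefE sR.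
Qed.

Lemma monic_of_degree_map (R : realType) n (p : {poly R}) :
  monic_of_degree n p -> monic_of_degree n (toC p).
Proof. by move=> [pm sp]; split; rewrite ?map_monic ?size_map_poly. Qed.

(** * The weighted norm on a compact set *)

(** The issue is that the set under [sup] is bounded: the weighted maxima of the real and imaginary
    parts add up to an upper bound. *)
Lemma weighted_le_wnorm (R : realType) (K : set R) (w : R -> R) (T : {poly R[i]}) x :
  compact K -> (forall x, K x -> 0 <= w x) -> upper_semicontinuous_on K w ->
  K x -> w x * Normc.normc T.[x%:C] <= wnorm K w T.
Proof.
move=> cK w0 usc Kx; have K0 : K !=set0 by exists x.
apply: ub_le_sup; last by exists x.
have [a Ka maxa] :=
  weighted_max cK K0 w0 usc (@continuous_horner _ (reP T)).
have [b Kb maxb] :=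
  weighted_max cK K0 w0 usc (@continuous_horner _ (imP T)).
eexists => _ [y Ky <-].
apply: le_trans (lerD (maxa y Ky) (maxb y Ky)).
by rewrite -mulrDr ler_wpM2l ?w0// -Re_horner -Im_horner normc_le_absReIm.
Qed.

Lemma wnorm_attained (R : realType) (K : set R) (w : R -> R) (p : {poly R}) :
  compact K -> K !=set0 -> (forall x, K x -> 0 <= w x) -> upper_semicontinuous_on K w ->
  exists2 x, K x & wnorm K w (toC p) = w x * `|p.[x]|.
Proof.
move=> cK K0 w0 usc.
have [x Kx maxx] := weighted_max cK K0 w0 usc (@continuous_horner _ p).
exists x => //; apply/eqP; rewrite eq_le; apply/andP; split.
  apply: ge_sup; first by eexists; exists x.
  by move=> _ [y Ky <-]; rewrite horner_map normc_real maxx.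
by have := weighted_le_wnorm (toC p) cK w0 usc Kx; rewrite horner_map normc_real.
Qed.

Lemma abs_le_wnorm (R : realType) (K : set R) (w : R -> R) (p : {poly R}) x :
  compact K -> (forall x, K x -> 0 <= w x) -> upper_semicontinuous_on K w ->
  K x -> w x * `|p.[x]| <= wnorm K w (toC p).
Proof.
move=> cK w0 usc Kx.
by have := weighted_le_wnorm (toC p) cK w0 usc Kx; rewrite horner_map normc_real.
Qed.

Lemma wnorm_Re_le (R : realType) (K : set R) (w : R -> R) (T : {poly R[i]}) :
  compact K -> K !=set0 -> (forall x, K x -> 0 <= w x) -> upper_semicontinuous_on K w ->
  wnorm K w (toC (reP T)) <= wnorm K w T.
Proof.
move=> cK K0 w0 usc.
have [x Kx ->] := wnorm_attained (reP T) cK K0 w0 usc.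
apply: le_trans (weighted_le_wnorm T cK w0 usc Kx).
by rewrite ler_wpM2l ?w0// -Re_horner normc_ge_absRe.
Qed.

(** A nonzero polynomial of degree at most [n] cannot vanish at [n.+1] points where the weight is
    positive. *)
Lemma wnorm_gt0 (R : realType) n (K : set R) (w : R -> R) (p : {poly R}) :
  compact K -> (forall x, K x -> 0 <= w x) -> upper_semicontinuous_on K w ->
  (`I_n.+1 #<= K `&` [set x | w x != 0])%card -> p != 0 -> (size p <= n.+1)%N ->
  0 < wnorm K w (toC p).
Proof.
move=> cK w0 usc /pcard_leP/unsquash f p0 sp.
have fK (j : 'I_n.+1) : (K `&` [set x | w x != 0]) (f j) by apply: funS => /=.
have finj : injective (fun j : 'I_n.+1 => f j).
  by move=> i j fij; apply: val_inj; apply: (inj (f := f)) fij; rewrite inE /=.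
have [j pj] : exists j : 'I_n.+1, p.[f j] != 0.
  apply/existsP; apply: contraNT p0; rewrite negb_exists => /forallP p0.
  by apply/eqP/(poly_eq0_at finj) => // j; apply/eqP; have := p0 j; rewrite negbK.
have [Kj wj] := fK j.
apply: lt_le_trans (abs_le_wnorm p cK w0 usc Kj).
by rewrite mulr_gt0 ?normr_gt0// lt_neqAle eq_sym wj w0.
Qed.

(** * Alternation and minimality *)

(** Stated over [R], so that signs can be compared; [alternates_complex] translates it to the form
    used in the theorem. *)
Definition alternates (R : realType) n (K : set R) (w : R -> R) (p : {poly R}) M :=
  exists x : 'I_n.+1 -> R,
    [/\ forall j, K (x j), forall i j : 'I_n.+1, (i < j)%N -> x i < x j &
        forall j : 'I_n.+1, w (x j) * p.[x j] = (-1) ^+ (n - j) * M].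

Lemma alternates_complex (R : realType) n (K : set R) (w : R -> R) (p : {poly R}) M :
  alternates n K w p M <->
  exists x : 'I_n.+1 -> R,
    [/\ forall j, K (x j), forall i j : 'I_n.+1, (i < j)%N -> x i < x j &
        forall j : 'I_n.+1,
          (w (x j))%:C * (toC p).[(x j)%:C] = (-1) ^+ (n - j) * M%:C].
Proof.
have eqC x (j : 'I_n.+1) :
    (w x)%:C * (toC p).[x%:C] = (-1) ^+ (n - j) * M%:C <->
    w x * p.[x] = (-1) ^+ (n - j) * M.
  rewrite horner_map -rmorphM/= -(rmorphN1 (real_complex R)) -rmorphXn -rmorphM/=.
  by split=> [/complexI|->].
by split=> -[x [xK incr xalt]]; exists x; split=> // j; apply/eqC.
Qed.

Lemma minimizer_alternates (R : realType) n (K : set R) (w : R -> R) (p : {poly R}) :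
  compact K -> (forall x, K x -> 0 <= w x) -> upper_semicontinuous_on K w ->
  0 < wnorm K w (toC p) -> monic_of_degree n p ->
  (forall q, monic_of_degree n q ->
    wnorm K w (toC p) <= wnorm K w (toC q)) ->
  alternates n K w p (wnorm K w (toC p)).
Proof.
move=> cK w0 usc; set M := wnorm K w _ => M0 [pm sp] pmin.
(* On the empty set [sup] takes the default value 0, against [M0]. *)
have [K0|/set0P K0] := eqVneq K set0.
  by move: M0; rewrite /M /wnorm K0 image_set0 sup0 ltxx.
pose A := [set x | K x /\ w x * p.[x] = M].
pose B := [set x | K x /\ w x * p.[x] = - M].
have [d d0 sep] := extremal_points_separated cK w0 usc (@continuous_horner _ p) M0.
have [N KN] : exists N, forall x, K x -> x <= N.
  have [N [_ KN]] := compact_bounded cK; exists (N + 1) => x Kx.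
  by apply: le_trans (ler_norm x) _; apply: (KN (N + 1)) => //; rewrite ltrDl.
have [|||[y [yAB ydec]]|[D [sD Dn DA DB _]]] :=
  @alternating_chain_or_poly R n A B d (N + d) d0.
- by move=> a b [Ka wa] [Kb wb]; exact: sep.
- by move=> x [Kx _]; rewrite addrK KN.
- by move=> x [Kx _]; rewrite addrK KN.
(* The chain decreases and starts in [A]. Reversing it makes the points increase, and the parity of
   [n - j] gives the sign. *)
- exists (fun j : 'I_n.+1 => y (n - j)%N); split.
  + by move=> j; have := yAB (n - j)%N (leq_subr _ _); case: odd => -[].
  + have ydec' i j : (i < j)%N -> (j <= n)%N -> y j < y i.
      elim: j => // j IH; rewrite ltnS leq_eqVlt => /orP[/eqP ->|ij] jn;
        first exact: ydec.
      by apply: lt_trans (ydec _ jn) (IH ij (ltnW jn)).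
    move=> i j ij; apply: ydec'; rewrite ?leq_subr//.
    by rewrite ltn_sub2l// (leq_trans ij)// -ltnS.
  + move=> j; have := yAB (n - j)%N (leq_subr _ _); rewrite -signr_odd.
    by case: odd => -[_ ->]; rewrite ?expr1 ?expr0 ?mulN1r ?mul1r.
have [e e0 pe] : exists2 e, 0 < e & forall x, K x -> w x * `|p.[x] - e * D.[x]| < M.
  apply: weighted_perturbation => //; try exact: continuous_horner.
  - by move=> x Kx; exact: abs_le_wnorm.
  - by move=> x Kx wM; apply: DA.
  - by move=> x Kx wM; apply: DB.
pose c := 1 - e * D`_n.
have c1 : 1 <= c by rewrite /c lerDl oppr_ge0 mulr_ge0_le0// ltW.
have c0 : 0 < c by apply: lt_le_trans c1.
pose q := c^-1 *: (p - e *: D).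
have qn : q`_n = 1.
  rewrite coefZ coefB coefZ.
  have -> : p`_n = 1 by move/monicP: pm; rewrite lead_coefE sp.
  by rewrite -/c mulVf// gt_eqF.
have sq : size q = n.+1.
  apply/eqP; rewrite eqn_leq; apply/andP; split.
    rewrite (leq_trans (size_scale_leq _ _))// (leq_trans (size_polyD _ _))//.
    by rewrite geq_max sp leqnn size_polyN (leq_trans (size_scale_leq _ _)).
  rewrite ltnNge; apply/negP => sq.
  by move: qn; rewrite nth_default// => /eqP; rewrite eq_sym oner_eq0.
have : M <= wnorm K w (toC q).
  by apply: pmin; split=> //; apply/monicP; rewrite lead_coefE sq.
have [x Kx ->] := wnorm_attained q cK K0 w0 usc.
rewrite hornerZ hornerD hornerN hornerZ normrM gtr0_norm ?invr_gt0// => Mle.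
have := lt_le_trans (pe x Kx) Mle; rewrite mulrCA ltNge => /negP[].
by rewrite ler_piMl ?invf_le1// mulr_ge0 ?w0.
Qed.

(** At each node [w * |Re T| <= M = w * |p|], so [p - Re T] is zero or has the sign of [p] there.
    The theorem applies this to the minimizer [T] twice, with [p] the real part of [T] and then of
    [P]. *)
Lemma alternates_unique (R : realType) n (K : set R) (w : R -> R) (p : {poly R})
    (T : {poly R[i]}) M :
  compact K -> (forall x, K x -> 0 <= w x) -> upper_semicontinuous_on K w ->
  0 < M -> monic_of_degree n p -> monic_of_degree n T -> alternates n K w p M ->
  wnorm K w T <= M -> T = toC p.
Proof.
move=> cK w0 usc M0 [pm sp] Tn [x [xK incr xalt]] TM.
set Q := reP T.
have [Qm sQ] : monic_of_degree n Q by exact: monic_of_degree_Re.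
have wx0 j : 0 < w (x j).
  rewrite lt_neqAle w0// andbT; apply/eqP => wx; have := xalt j.
  rewrite -wx mul0r => /esym/eqP; rewrite mulf_eq0 signr_eq0/=.
  by rewrite gt_eqF.
have wT j : w (x j) * Normc.normc T.[(x j)%:C] <= M.
  exact: le_trans (weighted_le_wnorm T cK w0 usc (xK j)) TM.
have pQ : p = Q.
  apply/eqP; rewrite -subr_eq0; apply/eqP/(alternating_poly_eq0 incr) => [|j].
    (* The leading terms of the two monic polynomials cancel, so the size drops to at most [n]. *)
    rewrite -ltnS ltn_neqAle; apply/andP; split; last first.
      by rewrite (leq_trans (size_polyD _ _))// size_polyN sp sQ maxnn.
    apply/eqP => sD; have : lead_coef (p - Q) = 0.
      rewrite lead_coefE sD/= coefB; move/monicP: pm; move/monicP: Qm.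
      by rewrite !lead_coefE sp sQ/= => -> ->; rewrite subrr.
    by move=> /eqP; rewrite lead_coef_eq0 -size_poly_eq0 sD.
  rewrite -(pmulr_rge0 _ (wx0 j)) mulrCA hornerD hornerN mulrBr.
  rewrite xalt mulrBr signrMK subr_ge0.
  apply: le_trans (ler_norm _) _; rewrite normrMsign normrM (gtr0_norm (wx0 j)).
  apply: le_trans (wT j); rewrite ler_pM2l// -Re_horner; exact: normc_ge_absRe.
(* At each node the real part alone already has weighted modulus [M], which leaves no room for an
   imaginary part; [n.+1] zeros then suffice. *)
have ImT : imP T = 0.
  apply: (poly_eq0_at (increasing_inj incr)) => [|j].
    by rewrite (leq_trans (size_poly _ _)) //; case: Tn => _ ->.
  have ReT : w (x j) * `|complex.Re T.[(x j)%:C]| = M.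
    rewrite Re_horner -/Q -pQ -[w _](gtr0_norm (wx0 j)) -normrM xalt.
    by rewrite normrMsign gtr0_norm.
  have := wT j; rewrite -Im_horner -{}ReT ler_pM2l//.
  case: T.[_] => a b /=; rewrite -sqrtr_sqr ler_sqrt ?sqr_ge0// ?addr_ge0 ?sqr_ge0//.
  by rewrite gerDl => b2; apply/eqP; rewrite -sqrf_eq0 eq_le b2 sqr_ge0.
apply/polyP => j; rewrite coef_map pQ coef_map_id0//=.
have := congr1 (fun r : {poly R} => r`_j) ImT; rewrite coef_map_id0// coef0.
by case: T`_j => a b /= ->.
Qed.

Theorem theorem7 (R : realType) (n : nat) (K : set R) (w : R -> R)
    (T : {poly R[i]})
    (n_ge1 : (1 <= n)%N)
    (K_compact : compact K)
    (w_ge0 : forall x, K x -> 0 <= w x)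
    (w_bounded : exists M : R, forall x, K x -> w x <= M)
    (w_usc : upper_semicontinuous_on K w)
    (w_support : (`I_n.+1 #<= K `&` [set x | w x != 0])%card)
    (T_chebyshev : weighted_chebyshev n K w T) :
  real_poly T /\
  forall P : {poly R[i]}, real_poly P -> monic_of_degree n P ->
    (P = T <->
     exists x : 'I_n.+1 -> R,
       [/\ forall j, K (x j),
           forall i j : 'I_n.+1, (i < j)%N -> x i < x j &
           forall j : 'I_n.+1,
             (w (x j))%:C * P.[(x j)%:C] = (-1) ^+ (n - j) * (wnorm K w P)%:C]).
Proof.
have K0 : K !=set0.
  have /pcard_leP/unsquash f := w_support.
  have [Kf _] : (K `&` [set x | w x != 0]) (f 0%N) by apply: funS => /=.
  by exists (f 0%N).
have [Tn Tmin] := T_chebyshev.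
pose Q := reP T.
have Qn : monic_of_degree n Q by exact: monic_of_degree_Re.
have pos p : monic_of_degree n p -> 0 < wnorm K w (toC p).
  move=> [pm sp]; apply: (wnorm_gt0 K_compact w_ge0 w_usc w_support) => //.
    exact: monic_neq0.
  by rewrite sp.
have Qalt : alternates n K w Q (wnorm K w (toC Q)).
  apply: minimizer_alternates => // [|q qn]; first exact: pos.
  apply: le_trans (wnorm_Re_le _ K_compact K0 w_ge0 w_usc) _.
  by apply: Tmin; exact: monic_of_degree_map.
have TQ : T = toC Q.
  apply: (alternates_unique K_compact w_ge0 w_usc (pos _ Qn) Qn Tn Qalt).
  by apply: Tmin; exact: monic_of_degree_map.
split; first by rewrite TQ; exact: real_poly_map.
move=> P Preal Pn; have PE := real_polyE Preal; have pn := monic_of_degree_Re Pn.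
split=> [->|].
  by rewrite TQ; apply/alternates_complex.
(* [P] alternates with its own norm, which bounds that of [T] by minimality. *)
rewrite -PE => /alternates_complex palt; apply/esym.
apply: (alternates_unique K_compact w_ge0 w_usc (pos _ pn) pn Tn palt).
by apply: Tmin; exact: monic_of_degree_map.
Qed.
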